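(* Let $\mathfrak g$ and $V$ be vector spaces over $\mathbf K$, and let $\mu\in\mathrm{Hom}(\wedge^2\mathfrak g,\mathfrak g)$, $\rho\in\mathrm{Hom}(\mathfrak g\otimes V,V)$ and $T\in\mathrm{Hom}(V,\mathfrak g)$ be linear maps. Put $\pi=\mu+\rho\in C^{1|0}(\mathfrak g\oplus V,\mathfrak g\oplus V)$. Then $((\mathfrak g,\mu),\rho,T)$ is a relative Rota-Baxter Lie algebra if and only if $(s^{-1}\pi,T)$ is a Maurer-Cartan element of the $L_\infty$-algebra $(s^{-1}L'\oplus\mathfrak h,\{l_i\}_{i\ge1})$ described in the context.
   Context: $\mathbf K$ is a field of characteristic $0$. $\mathbb S_{(i,j)}$ denotes the set of $(i,j)$-shuffles, $\varepsilon(\sigma)$ the Koszul sign. Relative Rota-Baxter Lie algebra: a triple $((\mathfrak g,[\cdot,\cdot]_{\mathfrak g}),\rho,T)$ with $(\mathfrak g,[\cdot,\cdot]_{\mathfrak g})$ a Lie algebra (also written $(\mathfrak g,\mu)$ with $\mu=[\cdot,\cdot]_{\mathfrak g}$), $\rho:\mathfrak g\to\mathfrak{gl}(V)$ a representation, and $T:V\to\mathfrak g$ linear with $[Tu,Tv]_{\mathfrak g}=T(\rho(Tu)(v)-\rho(Tv)(u))$ for all $u,v\in V$. Nijenhuis-Richardson bracket and bidegree: put $C^n(\mathfrak g\oplus V,\mathfrak g\oplus V)=\mathrm{Hom}(\wedge^{n+1}(\mathfrak g\oplus V),\mathfrak g\oplus V)$ (degree $n\ge0$) and $L=\bigoplus_{n\ge0}C^n(\mathfrak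 g\oplus V,\mathfrak g\oplus V)$. For $P,Q$ of degrees $p,q$, $[P,Q]_{NR}=P\bar\circ Q-(-1)^{pq}Q\bar\circ P$ with $(P\bar\circ Q)(x_1,\dots,x_{p+q+1})=\sum_{\sigma\in\mathbb S_{(q+1,p)}}(-1)^\sigma P(Q(x_{\sigma(1)},\dots,x_{\sigma(q+1)}),x_{\sigma(q+2)},\dots,x_{\sigma(p+q+1)})$; this makes $L$ a graded Lie algebra. A map $f\in\mathrm{Hom}(\wedge^{k+l+1}(\mathfrak g\oplus V),\mathfrak g\oplus V)$ has bidegree $k|l$ if $f$ maps $\wedge^{k+1}\mathfrak g\otimes\wedge^lV$ to $\mathfrak g$, maps $\wedge^k\mathfrak g\otimes\wedge^{l+1}V$ to $V$, and vanishes on all other $\wedge^a\mathfrak g\otimes\wedge^bV$; the space of these is $C^{k|l}$. Multilinear maps $f:\wedge^k\mathfrak g\otimes\wedge^lV\to\mathfrak g$ (or $\to V$) are regarded as elements of $C^{k+l-1}$ via the lift $\hat f((x_1,v_1),\dots,(x_{k+l},v_{k+l}))=\sum_{\tau\in\mathbb S_{(k,l)}}(-1)^\tau f(x_{\tau(1)},\dots,x_{\tau(k)},v_{\tau(k+1)},\dots,v_{\tau(k+l)})$, placed in the summand $\mathfrak g$ (respectively $V$). Thus $C^{k|0}\cong\mathrm{Hom}(\wedge^{k+1}\mathfrak g,\mathfrak g)\oplus\mathrm{Hom}(\wedge^k\mathfrak g\otimes V,V)$ and $C^{-1|l}\cong\mathrm{Hom}(\wedge^lV,\mathfrak g)$.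 $L_\infty$-algebra: a $\mathbb Z$-graded vector space $E$ with degree $1$ graded symmetric maps $l_k:\otimes^kE\to E$ ($k\ge1$) with $\sum_{i=1}^n\sum_{\sigma\in\mathbb S_{(i,n-i)}}\varepsilon(\sigma)l_{n-i+1}(l_i(x_{\sigma(1)},\dots,x_{\sigma(i)}),x_{\sigma(i+1)},\dots,x_{\sigma(n)})=0$ for all $n\ge1$. A Maurer-Cartan element is $\alpha\in E^0$ with $\sum_{k\ge1}\frac1{k!}l_k(\alpha,\dots,\alpha)=0$ (in the algebra below the sum is finite). The $L_\infty$-algebra $s^{-1}L'\oplus\mathfrak h$: $L'=\bigoplus_{n\ge0}C^{n|0}(\mathfrak g\oplus V,\mathfrak g\oplus V)$, a graded Lie subalgebra of $L$ with $C^{n|0}$ in degree $n$; $\mathfrak h=\bigoplus_{n\ge0}C^{-1|(n+1)}=\bigoplus_{n\ge0}\mathrm{Hom}(\wedge^{n+1}V,\mathfrak g)$ with $\mathrm{Hom}(\wedge^{n+1}V,\mathfrak g)$ in degree $n$; $(s^{-1}L')^i=L'^{i+1}$; $P:L\to L$ is the projection onto $\mathfrak h$ along the other bidegree components. The operations are $l_2(s^{-1}Q,s^{-1}Q')=(-1)^{Q}s^{-1}[Q,Q']_{NR}$ and $l_k(s^{-1}Q,\theta_1,\dots,\theta_{k-1})=P[\cdots[[Q,\theta_1]_{NR},\theta_2]_{NR},\cdots,\theta_{k-1}]_{NR}$ for homogeneous $Q,Q'\in L'$, $\theta_i\in\mathfrak h$; all operations not obtained from these by permuting arguments (with Koszul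 signs) vanish. *)

(* Defs.v *)
From HB Require Import structures.
From mathcomp Require Import all_boot all_order all_algebra all_fingroup.
From mathcomp Require Import boolp functions.

Set Implicit Arguments.
Unset Strict Implicit.
Unset Printing Implicit Defensive.

Import GRing.Theory.
Local Open Scope ring_scope.

(* (i, n-i)-shuffles: indices are counted from 0, so the two blocks of
   positions are [0, i) and [i, n). *)
Definition shuffle (n i : nat) (s : 'S_n) : bool :=
  [forall a : 'I_n, forall b : 'I_n,
    (a < b)%N && ((b < i)%N || (i <= a)%N) ==> (s a < s b)%N].

Section RelativeRotaBaxter.
Variables (K : fieldType) (g V : lmodType K).

Definition is_Lie_bracket (mu : g -> g -> g) : Prop :=
  [/\ bilinear_for *:%R *:%R mu,
      forall x, mu x x = 0 &
      forall x y z, mu x (mu y z) + mu y (mu z x) + mu z (mu x y) = 0].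

(* rho : g -> gl(V), the bracket of gl(V) being the commutator. *)
Definition is_representation (mu : g -> g -> g) (rho : g -> V -> V) : Prop :=
  bilinear_for *:%R *:%R rho /\
  forall x y v, rho (mu x y) v = rho x (rho y v) - rho y (rho x v).

Definition relative_Rota_Baxter_Lie_algebra
    (mu : g -> g -> g) (rho : g -> V -> V) (T : V -> g) : Prop :=
  [/\ is_Lie_bracket mu, is_representation mu rho, linear T &
      forall u v, mu (T u) (T v) = T (rho (T u) v - rho (T v) u)].

End RelativeRotaBaxter.

Section MultilinearMaps.
Variables (K : fieldType) (W : lmodType K).

Definition slot (n : nat) (x : 'I_n -> W) (i : 'I_n) (u : W) : 'I_n -> W :=
  fun j => if j == i then u else x j.

(* f belongs to Hom(/\^n W, W) *)
Definition alternating_multilinear (n : nat) (f : ('I_n -> W) -> W) : Prop :=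
  (forall x i, linear (fun u => f (slot x i u))) /\
  (forall x i j, i != j -> x i = x j -> f x = 0).

End MultilinearMaps.

(* The ambient space of L: the component at n : nat of a family is a function of
   n.+1 arguments.  Alternation, multilinearity and the bidegree conditions are
   imposed by the homogeneous subspaces below. *)
Definition cochains (K : fieldType) (W : lmodType K) : Type :=
  forall n : nat, ('I_n.+1 -> W) -> W.

Section CochainsLmodule.
Variables (K : fieldType) (W : lmodType K).
Local Notation L := (cochains W).

HB.instance Definition _ := gen_eqMixin L.
HB.instance Definition _ := gen_choiceMixin L.

Definition cochains_zero : L := fun n x => 0.
Definition cochains_opp (f : L) : L := fun n x => - f n x.
Definition cochains_add (f h : L) : L := fun n x => f n x + h n x.
Definition cochains_scale (a : K) (f : L) : L := fun n x => a *: f n x.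

Lemma cochainsP (f h : L) : (forall n x, f n x = h n x) -> f = h.
Proof. by move=> fh; apply: functional_extensionality_dep => n; apply/funext. Qed.

Fact cochains_addA : associative cochains_add.
Proof. by move=> f h k; apply: cochainsP => n x; apply: addrA. Qed.
Fact cochains_addC : commutative cochains_add.
Proof. by move=> f h; apply: cochainsP => n x; apply: addrC. Qed.
Fact cochains_add0 : left_id cochains_zero cochains_add.
Proof. by move=> f; apply: cochainsP => n x; apply: add0r. Qed.
Fact cochains_addN : left_inverse cochains_zero cochains_opp cochains_add.
Proof. by move=> f; apply: cochainsP => n x; apply: addNr. Qed.

HB.instance Definition _ := GRing.isZmodule.Build L
  cochains_addA cochains_addC cochains_add0 cochains_addN.

Fact cochains_scaleA a b (f : L) :
  cochains_scale a (cochains_scale b f) = cochains_scale (a * b) f.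
Proof. by apply: cochainsP => n x; apply: scalerA. Qed.
Fact cochains_scale1 : left_id 1 cochains_scale.
Proof. by move=> f; apply: cochainsP => n x; apply: scale1r. Qed.
Fact cochains_scaleDr : right_distributive cochains_scale +%R.
Proof. by move=> a f h; apply: cochainsP => n x; apply: scalerDr. Qed.
Fact cochains_scaleDl (f : L) :
  {morph cochains_scale^~ f : a b / a + b}.
Proof. by move=> a b; apply: cochainsP => n x; apply: scalerDl. Qed.

HB.instance Definition _ := GRing.Zmodule_isLmodule.Build K L
  cochains_scaleA cochains_scale1 cochains_scaleDr cochains_scaleDl.

End CochainsLmodule.

Section NijenhuisRichardson.
Variables (K : fieldType) (W : lmodType K).

(* For n = p + q.  When j > 0, position q + j (from 0) is the j-th one after
   the q.+1 positions given to Q. *)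
Definition NR_circ (n p q : nat) (P : ('I_p.+1 -> W) -> W)
    (Q : ('I_q.+1 -> W) -> W) (x : 'I_n.+1 -> W) : W :=
  \sum_(s : 'S_n.+1 | shuffle q.+1 s)
    (-1) ^+ s *: P (fun j : 'I_p.+1 =>
      if j == ord0 then Q (fun i : 'I_q.+1 => x (s (inord i)))
      else x (s (inord (q + j)))).

(* The bilinear extension of the bracket: in degree n the components of degrees
   p and q with p + q = n contribute. *)
Definition NR_bracket (P Q : cochains W) : cochains W := fun n x =>
  \sum_(q < n.+1)
    (NR_circ (P (n - q)%N) (Q q) x -
     (-1) ^+ ((n - q) * q) *: NR_circ (Q q) (P (n - q)%N) x).

End NijenhuisRichardson.

Section Bidegree.
Variables (K : fieldType) (g V : lmodType K).
Local Notation W := (g * V)%type.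
Local Notation L := (cochains W).

(* The arguments indexed by A lie in g and the others lie in V; since f is
   alternating, allowing any A with #|A| = a amounts to evaluating f on
   /\^a g (x) /\^b V with a + b = n.+1. *)
Definition has_bidegree (k l : int) (n : nat) (f : ('I_n.+1 -> W) -> W) : Prop :=
  [/\ n%:Z = k + l, alternating_multilinear f &
    forall (A : {set 'I_n.+1}) (x : 'I_n.+1 -> W),
      (forall i, if i \in A then (x i).2 = 0 else (x i).1 = 0) ->
      if #|A|%:Z == k + 1 then (f x).2 = 0
      else if #|A|%:Z == k then (f x).1 = 0
      else f x = 0].

(* The lift of f : /\^k g (x) /\^l V -> g (+) V, an element of degree k + l - 1. *)
Definition lift_cochain (k l : nat) (f : ('I_k -> g) -> ('I_l -> V) -> W) : L :=
  fun n x =>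
    if (k + l == n.+1)%N then
      \sum_(t : 'S_n.+1 | shuffle k t)
        (-1) ^+ t *: f (fun i => (x (t (inord i))).1)
                       (fun j => (x (t (inord (k + j)))).2)
    else 0.

Definition lift_mu (mu : g -> g -> g) : L :=
  @lift_cochain 2 0 (fun x _ => (mu (x ord0) (x ord_max), 0)).
Definition lift_rho (rho : g -> V -> V) : L :=
  @lift_cochain 1 1 (fun x v => (0, rho (x ord0) (v ord0))).
Definition lift_T (T : V -> g) : L :=
  @lift_cochain 0 1 (fun _ v => (T (v ord0), 0)).

(* f belongs to C^(d|0), placed in degree d. *)
Definition homogeneous_L' (d : int) (f : L) : Prop :=
  forall n, if n%:Z == d then has_bidegree d 0 (f n) else f n = fun=> 0.

(* f belongs to C^(-1|(d+1)), placed in degree d. *)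
Definition homogeneous_h (d : int) (f : L) : Prop :=
  forall n, if n%:Z == d then has_bidegree (-1) (d + 1) (f n) else f n = fun=> 0.

(* In degree n, the component of bidegree -1|(n+1) of f is the part of f that
   maps /\^(n+1) V to g. *)
Definition proj_h (f : L) : L := fun n x =>
  ((f n (fun i => (0, (x i).2))).1, 0).
Arguments proj_h f n x : clear implicits.

Lemma slot_id n (x : 'I_n -> W) i : slot x i (x i) = x.
Proof. by apply/funext => j; rewrite /slot; case: eqP => // ->. Qed.

Lemma slot_split n (f : ('I_n -> W) -> W) x i : alternating_multilinear f ->
  f x = f (slot x i ((x i).1, 0)) + f (slot x i (0, (x i).2)).
Proof.
move=> [flin _]; have := flin x i 1 ((x i).1, 0) (0, (x i).2).
rewrite !scale1r => <-; rewrite -[in LHS](slot_id x i); congr (f (slot x i _)).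
by rewrite [LHS]surjective_pairing; congr pair; rewrite /= ?addr0 ?add0r.
Qed.

Lemma bidegree_h_vanish l n (f : ('I_n.+1 -> W) -> W) x i :
  has_bidegree (-1) l f -> (x i).2 = 0 -> f x = 0.
Proof.
move=> [_ falt fpure].
have [m] := ubnP #|[set j | ((x j).1 != 0) && ((x j).2 != 0)]|.
elim: m x => // m IHm x lem xi0.
have [mix0|[j]] := set_0Vmem [set j | ((x j).1 != 0) && ((x j).2 != 0)].
  have A0 : (0 < #|[set j | (x j).2 == 0%R]|)%N.
    by apply/card_gt0P; exists i; rewrite inE xi0.
  have := fpure [set j | (x j).2 == 0] x; rewrite addNr eqz_nat -leqn0 leqNgt A0.
  have -> : (#|[set j | (x j).2 == 0]|%:Z == -1) = false by [].
  move=> fx; apply: fx => j; rewrite inE.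
  case: eqP => // /eqP xj; apply/eqP/negPn/negP => xj1.
  by move/setP: mix0 => /(_ j); rewrite !inE xj1 xj.
rewrite inE => /andP[xj1 xj2].
have ij : i != j by apply: contraNneq xj2 => <-; rewrite xi0.
have mixj (u : W) : (u.1 == 0) || (u.2 == 0) ->
    (#|[set h | ((slot x j u h).1 != 0%R) && ((slot x j u h).2 != 0%R)]| < m)%N.
  move=> u0; rewrite ltnS in lem; apply: leq_trans lem; apply: proper_card; apply/properP; split.
    by apply/subsetP => h; rewrite !inE /slot; case: (eqVneq h j) => [->|//]; rewrite xj1 xj2.
  by exists j; rewrite !inE ?xj1 // /slot eqxx -negb_or u0.
rewrite (slot_split x j falt) !IHm ?addr0 //; try by apply: mixj; rewrite /= eqxx ?orbT.
- by rewrite /slot (negPf ij).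
- by rewrite /slot (negPf ij).
Qed.

Lemma proj_h_id d f : homogeneous_h d f -> proj_h f = f.
Proof.
move=> fd; apply: cochainsP => n x; have := fd n; rewrite /proj_h.
case: eqP => [_ fn|_ ->] //; have [_ falt fpure] := fn.
have step (m : nat) :
    f n x = f n (fun i : 'I_n.+1 => if (i < m)%N then (0%R, (x i).2) else x i).
  elim: m => [|m IHm]; first by congr (f n _).
  have [mn|nm] := ltnP m n.+1; last first.
    rewrite IHm; congr (f n _); apply/funext => i.
    by rewrite !(leq_trans (ltn_ord i)) // (leq_trans nm).
  rewrite IHm (slot_split _ (Ordinal mn) falt).
  rewrite (bidegree_h_vanish (i := Ordinal mn) fn) ?add0r ?{1}/slot ?eqxx //.
  congr (f n _); apply/funext => j; rewrite /slot /= ltnn ltnS.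
  have [->|jm] := eqVneq j (Ordinal mn); first by rewrite leqnn.
  by rewrite [in RHS]leq_eqVlt -[_ == m]/(j == Ordinal mn) (negPf jm).
rewrite (step n.+1) [RHS]surjective_pairing.
have -> : (fun i : 'I_n.+1 => if (i < n.+1)%N then (0%R, (x i).2) else x i)
    = (fun i => (0, (x i).2)) by apply/funext => i; rewrite ltn_ord.
congr pair; have := fpure set0 (fun i => (0, (x i).2)).
by rewrite cards0 addNr eqxx => -> // i; rewrite inE.
Qed.

Lemma proj_h_other k l n (f : L) :
  k != -1 -> has_bidegree k l (f n) -> proj_h f n = fun=> 0.
Proof.
move=> k1 [_ _ fpure]; apply/funext => x; rewrite /proj_h.
have := fpure set0 (fun i => (0, (x i).2)); rewrite cards0.
rewrite eq_sym addr_eq0 (negPf k1).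
case: ifP => _ -> //; by move=> i; rewrite inE.
Qed.

End Bidegree.

Arguments proj_h {K g V} f n x.
Arguments lift_mu {K g} V mu n x.
Arguments lift_rho {K g V} rho n x.
Arguments lift_T {K g V} T n x.

(* A Z-graded vector space, given by the subspaces of homogeneous elements of an
   ambient vector space, with operations on homogeneous elements:
   gr_op d x is l_k(x_1, ..., x_k) for x_i homogeneous of degree d_i (its value
   on other arguments is irrelevant).  The L_infty identities are not recorded:
   being a Maurer-Cartan element only involves these data. *)
Record graded_operations (K : fieldType) := GradedOperations {
  gr_space : lmodType K;
  gr_homogeneous : int -> gr_space -> Prop;
  gr_op : forall k : nat, ('I_k -> int) -> ('I_k -> gr_space) -> gr_space }.

(* The infinite sum is required to be finite: l_k(alpha, ..., alpha) vanishes for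
   k > N. *)
Definition Maurer_Cartan (K : fieldType) (E : graded_operations K)
    (alpha : gr_space E) : Prop :=
  let term k := gr_op (fun _ : 'I_k => 0) (fun=> alpha) in
  gr_homogeneous 0 alpha /\
  exists N : nat, (forall k, (N < k)%N -> term k = 0) /\
    \sum_(1 <= k < N.+1) (k`!%:R : K)^-1 *: term k = 0.

Section TheAlgebra.
Variables (K : fieldType) (g V : lmodType K).
Local Notation L := (cochains (g * V)%type).
(* (Q, theta) stands for s^{-1}Q + theta *)
Local Notation E := (L * L)%type.

Definition RB_homogeneous (d : int) (x : E) : Prop :=
  homogeneous_L' (d + 1) x.1 /\ homogeneous_h d x.2.

(* Q has degree d + 1 in L' when s^{-1}Q has degree d. *)
Definition RB_op_L' (k : nat) : ('I_k -> int) -> ('I_k -> E) -> L :=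
  match k return ('I_k -> int) -> ('I_k -> E) -> L with
  | 2 => fun d x =>
      ((-1) ^ (d ord0 + 1) : K) *: NR_bracket (x ord0).1 (x ord_max).1
  | _ => fun _ _ => 0
  end.

(* The i-th argument provides s^{-1}Q and the others the theta's; the sign is the
   Koszul sign of moving s^{-1}Q to the first position. *)
Definition RB_op_h (k : nat) (d : 'I_k -> int) (x : 'I_k -> E) : L :=
  \sum_(i < k)
    ((-1) ^ (d i * \sum_(j < k | (j < i)%N) d j) : K) *:
    proj_h (foldl (@NR_bracket K _) (x i).1
                  [seq (x j).2 | j <- enum 'I_k & j != i]).

Definition RB_Linfty : graded_operations K :=
  @GradedOperations K E RB_homogeneous
    (fun k d x => (RB_op_L' d x, RB_op_h d x)).

End TheAlgebra.

(* Main.v *)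
From HB Require Import structures.
Require Import Defs.
From mathcomp Require Import all_boot all_order all_algebra.
From mathcomp Require Import all_fingroup boolp.
Import GRing.Theory.
Local Open Scope ring_scope.

(** Write W = g (+) V.  The cochain pi = mu + rho is the semidirect product
    bracket b((x, u), (y, v)) = (mu x y, rho x v - rho y u) on W, placed in
    degree 1, and the lift of T is the endomorphism t(x, u) = (T u, 0) of W,
    placed in degree 0; t has square zero and its image is g.

    Let alpha = (s^-1 pi, T).  Since s^-1 pi may occur only once beside copies
    of T, or twice in l_2, the Maurer-Cartan sum splits into two components.

    - In L' it is l_2 / 2! = - [pi, pi] / 2, and [pi, pi] is twice the
      Jacobiator of b.  On g it is the Jacobiator of mu, and on two arguments
      of g and one of V it is the defect of rho from being a representation, so
      it vanishes exactly when g is a Lie algebra acting on V by rho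
      (semidirect_JacobiP).

    - In h, l_k(alpha, ..., alpha) is k times the projection of pi bracketed
      k - 1 times with T.  The bracket with T sends a binary c to
      c(t -, -) + c(-, t -) - t c(-, -), by skewness.  Hence the projection
      vanishes for k = 1, 2 (no pair of arguments of V yields a value in g);
      for k = 3, because t^2 = 0, the double bracket is
      2 (b(t u, t v) - t (b(t u, v) + b(u, t v))) (derived_twice), which on V is
      twice the Rota-Baxter defect of T; for k >= 4 every surviving term
      contains t b(t -, t -) or t^2, both zero (derived_thrice).

    In characteristic zero the coefficients 1/2 * 2 and 3/3! * 2 are
    invertible, so the Maurer-Cartan equation says precisely that both defects
    vanish.

    The computations of brackets rest on the description of the shuffles with a
    last block of size one: they are the n + 1 permutations moving the last
    position to a chosen place i and keeping the order of the others, of sign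
    (-1)^(n + i) (big_shuffle_last). *)

(** * Shuffles with a block of size at most one *)

(** Induction gives s a >= a; the inverse of s is increasing too, which gives
    the opposite inequality. *)
Lemma increasing_perm1 {n : nat} (s : 'S_n) :
  (forall a b : 'I_n, (a < b)%N -> (s a < s b)%N) -> s = 1%g.
Proof.
have ge_id (t : 'S_n) : (forall a b : 'I_n, (a < b)%N -> (t a < t b)%N) ->
    forall a : 'I_n, (a <= t a)%N.
  move=> incr [m mn] /=; elim: m mn => // m IHm mn.
  exact: leq_ltn_trans (IHm (ltnW mn)) (incr (Ordinal (ltnW mn)) (Ordinal mn) _).
move=> incr; apply/permP => a; rewrite perm1; apply/val_inj/eqP.
rewrite eqn_leq ge_id // andbT.
have incrV (b c : 'I_n) : (b < c)%N -> (s^-1%g b < s^-1%g c)%N.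
  apply: contraTT; rewrite -!leqNgt leq_eqVlt => /orP[/eqP/val_inj E|].
    by rewrite -(perm_inj E).
  by move/incr; rewrite !permKV => /ltnW.
by have := ge_id _ incrV (s a); rewrite permK.
Qed.

Lemma one_block_shuffle {n i : nat} (s : 'S_n) :
  (i == 0%N) || (i == n) -> shuffle i s = (s == 1%g).
Proof.
move=> i0n; apply/idP/eqP => [/forallP sh|->].
  apply: increasing_perm1 => a b ab.
  have /forallP/(_ b)/implyP-> // := sh a; rewrite ab /=.
  by case/orP: i0n => /eqP->; rewrite ?ltn_ord ?orbT.
by apply/forallP => a; apply/forallP => b; rewrite !perm1; apply/implyP => /andP[].
Qed.

Lemma big_shuffle_one_block {R : nmodType} {n i : nat} (F : 'S_n -> R) :
  (i == 0%N) || (i == n) -> \sum_(s : 'S_n | shuffle i s) F s = F 1%g.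
Proof.
by move=> i0n; under eq_bigl => s do rewrite one_block_shuffle //; rewrite big_pred1_eq.
Qed.

Lemma lift_perm_lt {n : nat} (i a b : 'I_n.+1) : (a < b)%N -> (b < n)%N ->
  ((lift_perm ord_max i 1 : 'S_n.+1) a < (lift_perm ord_max i 1 : 'S_n.+1) b)%N.
Proof.
move=> ab bn; have an := ltn_trans ab bn.
have lt_lift (k : 'I_n.+1) (c d : 'I_n) : (lift k c < lift k d)%N = (c < d)%N.
  by rewrite !ltnNge /= leq_bump2.
case: (unliftP ord_max a) an ab => [a' ->|->]; last by rewrite ltnn.
case: (unliftP ord_max b) bn => [b' ->|->]; last by rewrite ltnn.
by rewrite !lift_perm_lift !perm1 !lt_lift.
Qed.

Lemma shuffle_lift_perm {n : nat} (i : 'I_n.+1) :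
  shuffle n (lift_perm ord_max i 1 : 'S_n.+1).
Proof.
apply/forallP => a; apply/forallP => b; apply/implyP => /andP[ab].
case/orP => [bn|na]; first exact: lift_perm_lt.
by have := leq_ltn_trans na ab; rewrite ltnNge -ltnS ltn_ord.
Qed.

(** Composing s with the inverse of the candidate fixes the last position and
    stays increasing on the others, so the composite is the identity. *)
Lemma shuffle_last {n : nat} (s : 'S_n.+1) :
  shuffle n s -> lift_perm ord_max (s ord_max) 1 = s.
Proof.
move=> /forallP sh; set t := lift_perm _ _ _.
suff : (s * t^-1)%g = 1%g by move=> E; apply/esym/eqP; rewrite eq_mulgV1 E.
have tmax : t ord_max = s ord_max by rewrite lift_perm_id.
have wmax : (s * t^-1)%g ord_max = ord_max by rewrite permM -tmax permK.
apply: increasing_perm1 => a b ab.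
have an : (a < n)%N by rewrite (leq_trans ab) // -ltnS ltn_ord.
have lt_max (c : 'I_n.+1) : (c < n)%N = (c != ord_max).
  by rewrite ltn_neqAle -[(c <= n)%N]ltnS ltn_ord andbT.
have wn (c : 'I_n.+1) : (c < n)%N -> ((s * t^-1)%g c < n)%N.
  by rewrite !lt_max -{2}wmax (inj_eq perm_inj).
have [bn|] := boolP (b < n)%N; last first.
  by rewrite lt_max negbK => /eqP->; rewrite wmax wn.
have /forallP/(_ b)/implyP sab := sh a.
have := sab; rewrite ab bn => /(_ isT); apply: contraTT.
rewrite -!leqNgt leq_eqVlt => /orP[/eqP/val_inj/perm_inj->//|wba].
have := lift_perm_lt (s ord_max) _ _ wba (wn _ an).
by rewrite -/t !permM !permKV => /ltnW.
Qed.

(** Turns sums over (n,1)-shuffles into sums over an ordinal, in which the signs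
    are given by odd_lift_perm. *)
Lemma big_shuffle_last {R : nmodType} {n : nat} (F : 'S_n.+1 -> R) :
  \sum_(s : 'S_n.+1 | shuffle n s) F s =
  \sum_(i < n.+1) F (lift_perm ord_max i 1).
Proof.
rewrite (reindex (fun i => lift_perm ord_max i 1)) /=.
  by apply: eq_bigl => i; rewrite shuffle_lift_perm.
exists (fun s : 'S_n.+1 => s ord_max) => [i _|s /= sh]; first exact: lift_perm_id.
exact: shuffle_last.
Qed.

(** * Cochains concentrated in one degree *)

Section Cochains.
Context {K : fieldType} {W : lmodType K}.

(** With P binary, the shuffles only choose the argument x i that Q does not
    receive. *)
Lemma NR_circ_binary {q : nat} (P : ('I_2 -> W) -> W) (Q : ('I_q.+1 -> W) -> W)
    (x : 'I_q.+2 -> W) :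
  NR_circ P Q x = \sum_(i < q.+2) (-1) ^+ (q.+1 + i) *:
    P (fun j => if j == ord0 then Q (fun a => x (lift i a)) else x i).
Proof.
rewrite /NR_circ big_shuffle_last; apply: eq_bigr => i _.
rewrite odd_lift_perm odd_perm1 addbF -oddD signr_odd; congr (_ *: P _).
apply/funext => j; case: eqP => [_|/eqP j0].
  congr Q; apply/funext => a.
  have -> : inord a = lift ord_max a :> 'I_q.+2.
    by apply: ord_inj; rewrite lift_max inordK // ltnS ltnW.
  by rewrite lift_perm_lift perm1.
congr x; rewrite -[RHS](lift_perm_id ord_max i 1); congr (fun_of_perm _ _).
by case: j j0 => [[|[]]] // jlt _; apply: ord_inj; rewrite inordK ?addn1.
Qed.

Lemma NR_circ_unary {q : nat} (P : ('I_1 -> W) -> W) (Q : ('I_q.+1 -> W) -> W)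
    (x : 'I_q.+1 -> W) :
  NR_circ P Q x = P (fun=> Q x).
Proof.
rewrite /NR_circ big_shuffle_one_block ?eqxx ?orbT // odd_perm1 scale1r.
congr P; apply/funext => j; rewrite ord1 eqxx; congr Q; apply/funext => i.
by rewrite perm1 inord_val.
Qed.

(** The arguments are reindexed through inord so that no cast between 'I_n.+1
    and 'I_d.+1 is needed when n = d holds only propositionally. *)
Definition in_degree (d : nat) (f : ('I_d.+1 -> W) -> W) : cochains W :=
  fun n x => if n == d then f (fun i => x (inord i)) else 0.

Lemma in_degreeE {d : nat} (f : ('I_d.+1 -> W) -> W) : in_degree d f d = f.
Proof.
apply/funext => x; rewrite /in_degree eqxx; congr f; apply/funext => i.
by rewrite inord_val.
Qed.

Lemma in_degree_neq {d n : nat} (f : ('I_d.+1 -> W) -> W) :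
  n != d -> in_degree d f n = fun=> 0.
Proof. by move=> nd; apply/funext => x; rewrite /in_degree (negPf nd). Qed.

Lemma in_degree0 (d : nat) : in_degree d (fun=> 0) = 0.
Proof. by apply: cochainsP => n x; rewrite /in_degree if_same. Qed.

(** A weak consequence of multilinearity, enough for a composition with the
    zero cochain inserted in the first slot to vanish. *)
Definition kills_head {d : nat} (f : ('I_d.+1 -> W) -> W) :=
  forall x, x ord0 = 0 -> f x = 0.

Lemma NR_circ0l {n p q : nat} (Q : ('I_q.+1 -> W) -> W) (x : 'I_n.+1 -> W) :
  NR_circ (fun _ : 'I_p.+1 -> W => 0) Q x = 0.
Proof. by rewrite /NR_circ big1 // => s _; rewrite scaler0. Qed.

Lemma NR_circ0r {n p q : nat} (P : ('I_p.+1 -> W) -> W) (x : 'I_n.+1 -> W) :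
  kills_head P -> NR_circ P (fun _ : 'I_q.+1 -> W => 0) x = 0.
Proof. by move=> P0; rewrite /NR_circ big1 // => s _; rewrite P0 ?scaler0. Qed.

Lemma kills_head_in_degree {d : nat} (f : ('I_d.+1 -> W) -> W) (n : nat) :
  kills_head f -> kills_head (in_degree d f n).
Proof.
have [->|nd] := eqVneq n d; first by rewrite in_degreeE.
by rewrite in_degree_neq.
Qed.

(** The bracket of L is additive in the degree: in its sum over the splittings
    of n, the term r = q is the only one where both components are nonzero, and
    it requires n = p + q. *)
Lemma NR_bracket_in_degree {p q : nat} (P : ('I_p.+1 -> W) -> W)
    (Q : ('I_q.+1 -> W) -> W) : kills_head P -> kills_head Q ->
  NR_bracket (in_degree p P) (in_degree q Q) =
  in_degree (p + q) (fun x => NR_circ P Q x - (-1) ^+ (p * q) *: NR_circ Q P x).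
Proof.
move=> P0 Q0; apply: cochainsP => n x; rewrite /NR_bracket.
have other r : (r != q) || (n - r != p)%N ->
    NR_circ (in_degree p P (n - r)%N) (in_degree q Q r) x -
    (-1) ^+ ((n - r) * r) *:
      NR_circ (in_degree q Q r) (in_degree p P (n - r)%N) x = 0.
  case/orP => ne; rewrite (in_degree_neq _ ne) NR_circ0l NR_circ0r ?scaler0 ?subr0 //;
  exact: kills_head_in_degree.
have [npq|npq] := eqVneq n (p + q)%N; last first.
  rewrite (in_degree_neq _ npq) big1 // => -[r /= rn] _; apply: other.
  apply: contraNT npq; rewrite negb_or !negbK => /andP[/eqP<- /eqP<-].
  by rewrite subnK.
subst n; rewrite in_degreeE.
have qn : (q < (p + q).+1)%N by rewrite ltnS leq_addl.
rewrite (bigD1 (Ordinal qn)) //= [X in _ + X]big1 ?addr0.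
  by rewrite addnK !in_degreeE.
by move=> r rq; apply: other; rewrite -(inj_eq val_inj) /= in rq; rewrite rq.
Qed.

Lemma NR_bracket0l (Q : cochains W) :
  (forall n, kills_head (Q n)) -> NR_bracket 0 Q = 0.
Proof.
move=> Q0; apply: cochainsP => n x; rewrite /NR_bracket big1 // => q _.
by rewrite NR_circ0l NR_circ0r ?scaler0 ?subr0.
Qed.

End Cochains.

(** * Brackets of unary and binary cochains *)

Section Binary.
Context {K : fieldType} {W : lmodType K}.
Implicit Types (b : W -> W -> W) (t : W -> W).

Definition binary_cochain b : cochains W :=
  in_degree 1 (fun x => b (x ord0) (x ord_max)).
Definition unary_cochain t : cochains W := in_degree 0 (fun x => t (x ord0)).

(** For a skew b, this is b(t u, v) + b(u, t v) - t b(u, v): the failure of t to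
    be a derivation of b. *)
Definition derived b t : W -> W -> W := fun u v => b (t u) v - b (t v) u - t (b u v).

(** The sum over the (2,1)-shuffles; for a skew b it is the usual cyclic sum. *)
Definition Jacobiator b (u v w : W) : W := b (b u v) w - b (b u w) v + b (b v w) u.

Lemma NR_bracket_binary_unary b t : (forall v, b 0 v = 0) -> t 0 = 0 ->
  NR_bracket (binary_cochain b) (unary_cochain t) = binary_cochain (derived b t).
Proof.
move=> b0 t0; rewrite NR_bracket_in_degree; first last.
- by move=> x ->.
- by move=> x ->.
congr in_degree; apply/funext => x.
rewrite NR_circ_binary NR_circ_unary !big_ord_recl big_ord0 addr0 /=.
rewrite expr1 expr0 scale1r sqrrN expr1n scale1r scaleN1r /derived.
have -> : lift (lift ord0 ord0 : 'I_2) ord0 = ord0 by apply: ord_inj.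
have -> : lift ord0 ord0 = ord_max :> 'I_2 by apply: ord_inj.
by congr (_ - _); rewrite addrC.
Qed.

(** Both terms of the graded commutator agree, as the degree 1 is odd; hence the
    factor 2. *)
Lemma NR_bracket_binary_self b : (forall v, b 0 v = 0) ->
  NR_bracket (binary_cochain b) (binary_cochain b) =
  in_degree 2 (fun x : 'I_3 -> W =>
    2%:R *: Jacobiator b (x ord0) (x (lift ord0 ord0)) (x ord_max)).
Proof.
move=> b0; rewrite NR_bracket_in_degree; try by move=> x ->.
congr in_degree; apply/funext => x.
rewrite mul1n expr1 scaleN1r opprK -mulr2n scaler_nat; congr (_ *+ _).
rewrite NR_circ_binary !big_ord_recl big_ord0 addr0 /=.
rewrite sqrrN expr1n scale1r -[(-1) ^+ (2 + bump 0 0)]signr_odd /= expr1 scaleN1r.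
rewrite -[(-1) ^+ (2 + _)]signr_odd /= expr0 scale1r /Jacobiator.
have -> : lift ord0 ord_max = ord_max :> 'I_3 by apply: ord_inj.
have -> : lift (lift ord0 ord0 : 'I_3) ord0 = ord0 by apply: ord_inj.
have -> : lift (lift ord0 ord0 : 'I_3) ord_max = ord_max by apply: ord_inj.
have -> : lift ord0 (lift ord0 ord0) = ord_max :> 'I_3 by apply: ord_inj.
have -> : lift (ord_max : 'I_3) ord0 = ord0 by apply: ord_inj.
have -> : lift (ord_max : 'I_3) ord_max = lift ord0 ord0 by apply: ord_inj.
by rewrite addrC; congr (_ + _); rewrite addrC.
Qed.

(** The terms where t is applied twice to one argument or value drop out, and
    each remaining one arises in two orders. *)
Lemma derived_twice b (t : {linear W -> W}) : (forall v, b 0 v = 0) ->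
  (forall u v, b u v = - b v u) -> (forall u, t (t u) = 0) ->
  derived (derived b t) t =
  fun u v => 2%:R *: (b (t u) (t v) - t (b (t u) v - b (t v) u)).
Proof.
move=> b0 bC tt; apply/funext => u; apply/funext => v; rewrite /derived !tt !b0.
rewrite (bC (t v) (t u)) !linearB /= tt.
rewrite !scaler_nat !mulr2n !opprK oppr0 addr0 !add0r.
rewrite [X in X + _ = _]addrACA -[LHS]addrA; congr (_ + _).
by rewrite addrACA opprD.
Qed.

(** A third t must meet another one, on an argument or on a value, or else be
    applied to b(t u, t v). *)
Lemma derived_thrice b (t : {linear W -> W}) : (forall v, b 0 v = 0) ->
  (forall u v, b u v = - b v u) -> (forall u, t (t u) = 0) ->
  (forall u v, t (b (t u) (t v)) = 0) ->
  derived (derived (derived b t) t) t = fun _ _ => 0.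
Proof.
move=> b0 bC tt tb; rewrite (derived_twice _ _ b0 bC tt).
apply/funext => u; apply/funext => v; rewrite /derived !tt !b0.
rewrite !linearZ /= !linearB /= !tb !tt raddf0.
by rewrite !(oppr0, scaler0, raddf0, addr0).
Qed.
End Binary.

(** * The semidirect product bracket *)

Section Semidirect.
Context {K : fieldType} {g V : lmodType K}.
Variables (mu : {bilinear g -> g -> g}) (rho : {bilinear g -> V -> V}).
Variable (T : {linear V -> g}).
Hypothesis mu_alt : forall x, mu x x = 0.
Local Notation W := (g * V)%type.

Lemma bracket_skew x y : mu x y = - mu y x.
Proof.
apply/eqP; rewrite -addr_eq0; apply/eqP.
by have := mu_alt (x + y); rewrite linearDl !linearDr /= !mu_alt add0r addr0.
Qed.

Definition semidirect_bracket (u v : W) : W :=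
  (mu u.1 v.1, rho u.1 v.2 - rho v.1 u.2).

Definition lifted_map (u : W) : W := (T u.2, 0).

Fact lifted_map_linear : linear lifted_map.
Proof.
move=> a u v; rewrite /lifted_map linearP.
by congr pair; rewrite /= scaler0 addr0.
Qed.
HB.instance Definition _ :=
  GRing.isLinear.Build K W W *:%R lifted_map lifted_map_linear.

Local Notation b := semidirect_bracket.

Lemma semidirect0l v : b 0 v = 0.
Proof. by rewrite /b /= !linear0l linear0r subrr. Qed.

Lemma semidirect_skew u v : b u v = - b v u.
Proof.
by rewrite /b bracket_skew; congr pair; rewrite opprB.
Qed.

Lemma lift_mu_rho_binary : lift_mu V mu + lift_rho rho = binary_cochain b.
Proof.
apply: cochainsP => n x; rewrite /binary_cochain.
have -> : (lift_mu V mu + lift_rho rho) n x = lift_mu V mu n x + lift_rho rho n x by [].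
rewrite /lift_mu /lift_rho /lift_cochain.
case: n x => [|[|n]] x; rewrite /= /in_degree ?addr0 //=.
rewrite big_shuffle_one_block // odd_perm1 scale1r big_shuffle_last.
rewrite !big_ord_recl big_ord0 addr0 !odd_lift_perm !odd_perm1 /= expr1 expr0.
have -> : inord 0 = ord0 :> 'I_2 by apply: ord_inj; rewrite inordK.
have -> : inord 1 = ord_max :> 'I_2 by apply: ord_inj; rewrite inordK.
have lp (i : 'I_2) : lift_perm ord_max i 1 ord0 = lift i ord0.
  have -> : ord0 = lift ord_max ord0 :> 'I_2 by apply: ord_inj.
  by rewrite lift_perm_lift perm1.
rewrite !lift_perm_id !lp !perm1.
have -> : lift (lift ord0 ord0 : 'I_2) ord0 = ord0 by apply: ord_inj.
have -> : lift ord0 ord0 = ord_max :> 'I_2 by apply: ord_inj.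
congr pair => /=; first by rewrite !scaler0 !addr0.
by rewrite scaleN1r scale1r add0r addrC.
Qed.

Lemma lift_T_unary : lift_T T = unary_cochain lifted_map.
Proof.
apply: cochainsP => n x; rewrite /lift_T /lift_cochain /unary_cochain /in_degree.
case: n x => [|n] x //=.
by rewrite big_shuffle_one_block // odd_perm1 scale1r perm1.
Qed.

(** Stated for arbitrary elements of W, so that the vanishing of both defects
    gives the Jacobi identity without a reduction to pure arguments. *)
Lemma semidirect_Jacobiator x y z u v w :
  Jacobiator b (x, u) (y, v) (z, w) =
  (- (mu x (mu y z) + mu y (mu z x) + mu z (mu x y)),
   (rho (mu x y) w - (rho x (rho y w) - rho y (rho x w)))
   - (rho (mu x z) v - (rho x (rho z v) - rho z (rho x v)))
   + (rho (mu y z) u - (rho y (rho z u) - rho z (rho y u)))).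
Proof.
rewrite /Jacobiator /b /=; congr pair => /=.
  rewrite [mu (mu x y) z]bracket_skew [mu (mu x z) y]bracket_skew.
  rewrite [mu (mu y z) x]bracket_skew (bracket_skew x z) linearNr /= opprK.
  by rewrite !opprD [LHS](ACl (3 * 2 * 1)).
rewrite !linearB /= !opprK !addrA.
by rewrite [LHS](ACl (1 * 8 * 5 * 4 * 9 * 2 * 7 * 6 * 3)).
Qed.

(** Pure arguments isolate the two defects: three from g for the Jacobi identity
    of mu, two from g and one from V for the representation property. *)
Lemma semidirect_JacobiP :
  (forall u v w, Jacobiator b u v w = 0) <->
  is_Lie_bracket mu /\ is_representation mu rho.
Proof.
split=> [J|[[_ _ J] [_ R]] [x u] [y v] [z w]]; last first.
  by rewrite semidirect_Jacobiator J !R !subrr !addr0 oppr0.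
split; split.
- by split=> *; [apply: linearPl | apply: linearPr].
- exact: mu_alt.
- move=> x y z; have := J (x, 0) (y, 0) (z, 0); rewrite semidirect_Jacobiator.
  by case=> /eqP; rewrite oppr_eq0 => /eqP.
- by split=> *; [apply: linearPl | apply: linearPr].
- move=> x y v; have := J (x, 0) (y, 0) (0, v); rewrite semidirect_Jacobiator.
  by case=> _; rewrite !linear0r !subr0 addr0 => /eqP; rewrite subr_eq0 => /eqP.
Qed.

End Semidirect.

(** * The Maurer-Cartan equation *)

Section MaurerCartan.
Context {K : fieldType} {g V : lmodType K}.
Variables (mu : {bilinear g -> g -> g}) (rho : {bilinear g -> V -> V}).
Variable (T : {linear V -> g}).
Hypothesis mu_alt : forall x, mu x x = 0.
Local Notation W := (g * V)%type.
Local Notation b := (semidirect_bracket mu rho).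
Local Notation t := (lifted_map T).
Local Notation alpha := (binary_cochain b, unary_cochain t).

Lemma lifted_map_sqr0 u : t (t u) = 0.
Proof. by rewrite /lifted_map /= linear0. Qed.

Lemma semidirect_linearl v : linear (b^~ v).
Proof.
move=> a u u'; rewrite /semidirect_bracket; congr pair => /=.
  by rewrite linearPl.
by rewrite linearPl linearP /= scalerBr opprD addrACA.
Qed.

Lemma semidirect_linearr u : linear (b u).
Proof.
move=> a v v'; rewrite semidirect_skew // semidirect_linearl.
by rewrite opprD -scalerN -!semidirect_skew.
Qed.

Lemma semidirect_alt u : b u u = 0.
Proof. by rewrite /semidirect_bracket mu_alt subrr. Qed.

Lemma ord2P (i : 'I_2) : i = ord0 \/ i = ord_max.
Proof. by case: i => [[|[|]]] // ?; [left | right]; apply: ord_inj. Qed.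

Lemma binary_cochainE (c : W -> W -> W) x :
  binary_cochain c 1 x = c (x ord0) (x ord_max).
Proof. by rewrite /binary_cochain in_degreeE. Qed.

Lemma semidirect_alternating :
  alternating_multilinear (binary_cochain b 1).
Proof.
split=> [x i a u v|x i j ij xij].
  rewrite !binary_cochainE /slot.
  by case: (ord2P i) => -> /=; [apply: semidirect_linearl | apply: semidirect_linearr].
rewrite binary_cochainE.
suff -> : x ord_max = x ord0 by apply: semidirect_alt.
by move: ij xij; case: (ord2P i) => ->; case: (ord2P j) => ->.
Qed.

Lemma semidirect_homogeneous : homogeneous_L' 1 (binary_cochain b).
Proof.
move=> n; case: eqP => [[->]|/eqP n1]; last exact: in_degree_neq.
split; [by [] | exact: semidirect_alternating |] => A x xA.
rewrite binary_cochainE.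
have := xA ord0; have := xA ord_max.
have -> : #|A| = ((ord0 \in A) + (ord_max \in A))%N.
  rewrite -sum1_card big_mkcond !big_ord_recl big_ord0 /= addn0.
  have -> : lift ord0 ord0 = ord_max :> 'I_2 by apply: ord_inj.
  by case: (ord0 \in A); case: (ord_max \in A).
rewrite /semidirect_bracket.
by case: (ord0 \in A); case: (ord_max \in A) => /= x1 x0;
  rewrite ?x0 ?x1 ?linear0r ?linear0l ?subr0.
Qed.

Lemma lift_T_homogeneous : homogeneous_h 0 (unary_cochain t).
Proof.
move=> n; case: eqP => [[->]|/eqP n0]; last exact: in_degree_neq.
rewrite /unary_cochain in_degreeE; split=> //.
- split=> [x i a u v|x i j]; last by rewrite !ord1 eqxx.
  by rewrite /slot [i]ord1 eqxx linearP.
- move=> A x xA; have := xA ord0.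
  have -> : #|A| = (ord0 \in A) :> nat.
    by rewrite -sum1_card big_mkcond big_ord1; case: ifP.
  by rewrite /lifted_map; case: (ord0 \in A) => //= ->; rewrite linear0.
Qed.

Lemma proj_h0 : proj_h (0 : cochains W) = 0.
Proof. by []. Qed.

Lemma proj_h_binary_eq0 (c : W -> W -> W) :
  proj_h (binary_cochain c) = 0 <-> forall u v, (c (0, u) (0, v)).1 = 0.
Proof.
split=> [c0 u v|c0].
  have := congr1 (fun f : cochains W =>
    (f 1%N (fun i => if i == ord0 then (0, u) else (0, v))).1) c0.
  by rewrite /proj_h binary_cochainE.
apply: cochainsP => n x; rewrite /proj_h /binary_cochain /in_degree.
by case: ifP => // _; rewrite c0.
Qed.

(** All degrees are 0, so the Koszul signs are trivial and the k possible places
    of s^-1 P contribute equally. *)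
Lemma RB_op_h_diag (k : nat) (P t0 : cochains W) :
  RB_op_h (fun _ : 'I_k => 0) (fun=> (P, t0)) =
  k%:R *: proj_h (foldl (@NR_bracket K W) P (nseq k.-1 t0)).
Proof.
have others (i : 'I_k) : [seq t0 | j <- enum 'I_k & j != i] = nseq k.-1 t0.
  have size_others : size [seq j <- enum 'I_k | j != i] = k.-1.
    have := cardC1 i; rewrite card_ord cardE => <-.
    rewrite {1}/enum_mem -filter_predI; congr size.
    by apply: eq_filter => j /=; rewrite !inE andbT.
  rewrite -size_others; by elim: [seq j <- _ | _] => //= a s ->.
rewrite /RB_op_h; under eq_bigr => i _ do rewrite mul0r expr0z scale1r others.
by rewrite sumr_const card_ord scaler_nat.
Qed.

Lemma foldl_bracket0 (m : nat) :
  foldl (@NR_bracket K W) 0 (nseq m (unary_cochain t)) = 0.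
Proof.
elim: m => //= m IHm; rewrite NR_bracket0l // => n.
by apply: kills_head_in_degree => x ->; rewrite linear0.
Qed.

(** Bidegree reasons in elementary form: with fewer than two T the arguments of V
    never produce a value in g, and with three or more the bracket itself is
    zero.  The sign of l_2 is the one of pi, which has degree 1. *)
Lemma Maurer_Cartan_term (k : nat) :
  gr_op (g := RB_Linfty g V) (fun _ : 'I_k => 0) (fun=> alpha) =
  match k with
  | 2 => (- NR_bracket (binary_cochain b) (binary_cochain b), 0)
  | 3 => (0, 3%:R *: proj_h (binary_cochain (derived (derived b t) t)))
  | _ => 0
  end.
Proof.
have b0 v := semidirect0l mu rho v.
have bC := semidirect_skew mu rho mu_alt.
have tt := lifted_map_sqr0.
have step c : (forall v, c 0 v = 0) ->
    NR_bracket (binary_cochain c) (unary_cochain t) = binary_cochain (derived c t).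
  by move=> c0; rewrite NR_bracket_binary_unary ?linear0.
(* Vanishing at 0 has to be propagated so that step applies three times. *)
have d0 c : (forall v, c 0 v = 0) -> (forall v, c v 0 = 0) ->
    (forall v, derived c t 0 v = 0).
  by move=> cl cr v; rewrite /derived !(linear0, cl, cr, addr0).
have br v : b v 0 = 0 by rewrite bC b0 oppr0.
have db0 := d0 b b0 br.
have dbr v : derived b t v 0 = 0 by rewrite /derived !(linear0, br, b0, addr0).
have ddb0 := d0 _ db0 dbr.
have tb u v : t (b (t u) (t v)) = 0.
  by rewrite /lifted_map /= !linear0r subrr linear0.
rewrite /gr_op /RB_Linfty RB_op_h_diag.
case: k => [|[|[|[|k]]]] /=.
- by rewrite scale0r.
- rewrite scale1r; congr pair; apply/proj_h_binary_eq0 => u v /=.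
  by rewrite linear0l.
- rewrite add0r expr1z scaleN1r; congr pair.
  rewrite step //.
  have -> : proj_h (binary_cochain (derived b t)) = 0.
    apply/proj_h_binary_eq0 => u v; rewrite /derived /=.
    by rewrite !(linear0r, linear0l, linear0, addr0).
  by rewrite scaler0.
- by rewrite !step.
- rewrite !step // (derived_thrice _ _ b0 bC tt tb) /binary_cochain in_degree0.
  by rewrite foldl_bracket0 proj_h0 scaler0.
Qed.

(** Makes the value of the Maurer-Cartan sum independent of the bound chosen for
    its support. *)
Lemma sum_nat_stable {M : nmodType} (F : nat -> M) (N N' : nat) :
  (forall k, (N < k)%N -> F k = 0) -> (N <= N')%N ->
  \sum_(1 <= k < N'.+1) F k = \sum_(1 <= k < N.+1) F k.
Proof.
move=> F0 NN'; rewrite (big_cat_nat (n := N.+1)) //=.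
by rewrite [X in _ + X]big_nat_cond [X in _ + X]big1 ?addr0 // => k /andP[/andP[/F0]].
Qed.

Hypothesis charK : [pchar K] =i pred0.

Lemma natr_neq0 (n : nat) : (n.+1%:R : K) != 0.
Proof. by have /pcharf0P-> := charK. Qed.

(** The only terms are l_2 / 2! and l_3 / 3!, in different summands of the space;
    as 3 / 3! = 1 / 2, both have the coefficient 1 / 2. *)
Lemma Maurer_Cartan_split :
  @Maurer_Cartan K (RB_Linfty g V) alpha <->
  NR_bracket (binary_cochain b) (binary_cochain b) = 0 /\
  proj_h (binary_cochain (derived (derived b t) t)) = 0.
Proof.
set B := NR_bracket _ _; set D := proj_h _.
pose term k : cochains W * cochains W :=
  gr_op (g := RB_Linfty g V) (fun _ : 'I_k => 0) (fun=> alpha).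
pose F k : cochains W * cochains W := (k`!%:R : K)^-1 *: term k.
have F3 k : (3 < k)%N -> F k = 0.
  by rewrite /F /term Maurer_Cartan_term; case: k => [|[|[|[|k]]]] //; rewrite scaler0.
have sumF : \sum_(1 <= k < 4) F k = (- (2%:R^-1 *: B), 2%:R^-1 *: D).
  rewrite /index_iota /= !big_cons big_nil /F /term !Maurer_Cartan_term.
  rewrite scaler0 add0r addr0; congr pair => /=.
    by rewrite scaler0 addr0 scalerN.
  rewrite scaler0 add0r scalerA factS natrM invfM mulrAC mulVf ?natr_neq0 //.
  by rewrite mul1r.
split=> [[_ [N [FN sumN]]]|[B0 D0]].
  have : \sum_(1 <= k < 4) F k = 0.
    rewrite -(sum_nat_stable _ _ _ F3 (leq_maxr N 3)) -[RHS]sumN.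
    apply: sum_nat_stable; last exact: leq_maxl.
    by move=> k /FN Fk; rewrite /F /term Fk scaler0.
  rewrite sumF => -[/eqP + /eqP]; rewrite oppr_eq0 !scaler_eq0 invr_eq0.
  by rewrite !(negPf (natr_neq0 1)) /= => /eqP-> /eqP->.
split; first by split; [apply: semidirect_homogeneous | apply: lift_T_homogeneous].
exists 3; split=> [k k3|].
  by rewrite Maurer_Cartan_term; case: k k3 => [|[|[|[|]]]].
by rewrite -[RHS]/(0, 0) -[LHS]/(\sum_(1 <= k < 4) F k) sumF B0 D0 !scaler0 oppr0.
Qed.

Lemma bracket_self_eq0P (c : W -> W -> W) : (forall v, c 0 v = 0) ->
  NR_bracket (binary_cochain c) (binary_cochain c) = 0 <->
  forall u v w, Jacobiator c u v w = 0.
Proof.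
move=> c0; rewrite NR_bracket_binary_self //; split=> [E u v w|J]; last first.
  by apply: cochainsP => n x; rewrite /in_degree J scaler0 if_same.
have := congr1 (fun f : cochains W => f 2 (fun i : 'I_3 => nth 0 [:: u; v; w] i)) E.
by rewrite in_degreeE /= => /eqP; rewrite scaler_eq0 (negPf (natr_neq0 1)) => /eqP.
Qed.

Lemma Rota_Baxter_defectP :
  proj_h (binary_cochain (derived (derived b t) t)) = 0 <->
  forall u v, mu (T u) (T v) = T (rho (T u) v - rho (T v) u).
Proof.
rewrite (derived_twice _ _ (semidirect0l mu rho) (semidirect_skew mu rho mu_alt)
  (lifted_map_sqr0)).
rewrite proj_h_binary_eq0.
have E u v :
    (2%:R *: (b (t (0, u)) (t (0, v)) - t (b (t (0, u)) (0, v) - b (t (0, v)) (0, u)))).1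
    = 2%:R *: (mu (T u) (T v) - T (rho (T u) v - rho (T v) u)).
  by rewrite /= !linear0l !subr0.
split=> TT u v.
  by have := TT u v; rewrite E => /eqP;
     rewrite scaler_eq0 (negPf (natr_neq0 1)) subr_eq0 => /eqP.
by rewrite E TT subrr scaler0.
Qed.

End MaurerCartan.

Theorem theorem3p13 (K : fieldType) (g V : lmodType K)
    (charK : [pchar K] =i pred0)
    (mu : {bilinear g -> g -> g}) (mu_alt : forall x : g, mu x x = 0)
    (rho : {bilinear g -> V -> V}) (T : {linear V -> g}) :
  let pi := lift_mu V mu + lift_rho rho in
  relative_Rota_Baxter_Lie_algebra mu rho T <->
  @Maurer_Cartan K (RB_Linfty g V) (pi, lift_T T).
Proof.
move=> pi; rewrite /pi lift_mu_rho_binary lift_T_unary Maurer_Cartan_split //.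
rewrite Rota_Baxter_defectP // bracket_self_eq0P ?semidirect_JacobiP //.
  by split=> [[? ? _ ?]|[[? ?] ?]]; split=> //; apply: linearP.
exact: semidirect0l.
Qed.
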